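(* Let $P\in\mathbb{R}^{n\times n}$ be a column stochastic matrix, $e=[1,\dots,1]^{\mathrm T}\in\mathbb{R}^n$, $v=e/n$, $\alpha\in(0,1)$, $\beta\in(0,\alpha)$, and let $m_1,m_2\ge 1$ be integers. Consider the MIIO iteration for $P,v,\alpha,\beta,m_1,m_2$ (defined in the context). Then the iteration matrix $M(\alpha,\beta)$ of the MIIO iteration is $$M(\alpha,\beta)=(\alpha-\beta)\,\beta^{m_2}\alpha^{m_1}\,P^{m_1+m_2+1}(I-\beta P)^{-1},$$ and the modulus of each of its eigenvalues is bounded by $$\frac{(\alpha-\beta)\,\beta^{m_2}\alpha^{m_1}}{1-\beta}.$$ Therefore $\rho(M(\alpha,\beta))<1$ (where $\rho$ is the spectral radius), and the MIIO iteration, started from any entrywise nonnegative $x^{(0)}\in\mathbb{R}^n$, converges to the unique solution $x^*\in\mathbb{C}^n$ of the system $Gx=x$, $e^{\mathrm T}x=1$, where $G=\alpha P+(1-\alpha)ve^{\mathrm T}$.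
   Context: A column stochastic matrix is a matrix with nonnegative entries each of whose columns sums to $1$. $I$ is the $n\times n$ identity matrix. MIIO (multi-step splitting) iteration: given an entrywise nonnegative $x^{(0)}\in\mathbb{R}^n$, for $l=0,1,2,\dots$ compute $x^{(l+1)}$ from $x^{(l)}$ as follows. First stage: set $y_0=x^{(l)}$ and $$y_j=\alpha P y_{j-1}+(1-\alpha)v,\qquad j=1,\dots,m_1 .$$ Put $f=(\alpha-\beta)P y_{m_1}+(1-\alpha)v$, set $x^{(l,0)}=y_{m_1}$ and $$x^{(l,j)}=\beta P x^{(l,j-1)}+f,\qquad j=1,\dots,m_2 .$$ Second stage: $x^{(l+1)}$ is the solution of $$(I-\beta P)x^{(l+1)}=(\alpha-\beta)P x^{(l,m_2)}+(1-\alpha)v .$$ The ''iteration matrix'' $M(\alpha,\beta)$ is the matrix multiplying $x^{(l)}$ when $x^{(l+1)}$ is written, by eliminating the intermediate vectors $y_j$ ($1\le j\le m_1$) and $x^{(l,j)}$ ($0\le j\le m_2$), as $M(\alpha,\beta)x^{(l)}$ plus terms involving only $v$ and $f$; that is, the vector $f$ is kept as a separate (inhomogeneous) term and is not expanded in terms of $x^{(l)}$. *)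

(* Defs.v *)
From HB Require Import structures.
From mathcomp Require Import all_boot all_order all_algebra.
From mathcomp.real_closed Require Import complex.
From mathcomp Require Import all_classical all_reals all_analysis.

Set Implicit Arguments.
Unset Strict Implicit.
Unset Printing Implicit Defensive.

Import Order.TTheory GRing.Theory Num.Theory.
Import numFieldNormedType.Exports.

Local Open Scope classical_set_scope.
Local Open Scope ring_scope.

Definition column_stochastic (R : realType) (n : nat) (P : 'M[R]_n) : Prop :=
  (forall i j, 0 <= P i j) /\ (forall j, \sum_i P i j = 1).

Definition ones (R : realType) (n : nat) : 'cV[R]_n := const_mx 1.

Definition unif (R : realType) (n : nat) : 'cV[R]_n := n%:R^-1 *: ones R n.

(* The ring [R[i]^o] is [R[i]] itself; the tag only makes the topology of
   [R[i]] as a normed field, hence that of C^n, available. *)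
Definition toC (R : realType) (m n : nat) (A : 'M[R]_(m, n)) :
    'M[R[i]^o]_(m, n) :=
  map_mx (real_complex R) A.

Definition modulus (R : realType) (z : R[i]) : R := ComplexField.Normc.normc z.

(* [eigenvalue] is defined through left eigenvectors; for a square matrix over
   a field the left and right eigenvalues coincide. The set below is finite,
   and nonempty as soon as n > 0, so its supremum is its maximum. *)
Definition spectral_radius (R : realType) (n : nat) (A : 'M[R]_n) : R :=
  sup [set modulus z | z in [set z : R[i] | eigenvalue (toC A : 'M[R[i]]_n) z]].

Definition google (R : realType) (n : nat) (P : 'M[R]_n) (a : R) : 'M[R]_n :=
  a *: P + (1 - a) *: (unif R n *m (ones R n)^T).

Definition miio_y (R : realType) (n : nat) (P : 'M[R]_n) (a : R) (m1 : nat)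
    (v x : 'cV[R]_n) : 'cV[R]_n :=
  iter m1 (fun y => a *: (P *m y) + (1 - a) *: v) x.

Definition miio_f (R : realType) (n : nat) (P : 'M[R]_n) (a b : R)
    (v y : 'cV[R]_n) : 'cV[R]_n :=
  (a - b) *: (P *m y) + (1 - a) *: v.

Definition miio_inner (R : realType) (n : nat) (P : 'M[R]_n) (b : R) (m2 : nat)
    (f y : 'cV[R]_n) : 'cV[R]_n :=
  iter m2 (fun z => b *: (P *m z) + f) y.

(* One outer step from x to x', in which the inhomogeneous term f of the inner
   iteration is an independent vector. *)
Definition miio_step_with (R : realType) (n : nat) (P : 'M[R]_n) (a b : R)
    (m1 m2 : nat) (v f x x' : 'cV[R]_n) : Prop :=
  (1%:M - b *: P) *m x' =
  (a - b) *: (P *m miio_inner P b m2 f (miio_y P a m1 v x)) + (1 - a) *: v.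

Definition miio_step (R : realType) (n : nat) (P : 'M[R]_n) (a b : R)
    (m1 m2 : nat) (v x x' : 'cV[R]_n) : Prop :=
  miio_step_with P a b m1 m2 v (miio_f P a b v (miio_y P a m1 v x)) x x'.

Definition miio_iterates (R : realType) (n : nat) (P : 'M[R]_n) (a b : R)
    (m1 m2 : nat) (v : 'cV[R]_n) (x : nat -> 'cV[R]_n) : Prop :=
  (forall i, 0 <= x 0%N i ord0) /\
  forall l, miio_step P a b m1 m2 v (x l) (x l.+1).

(* M is the coefficient of x when the intermediate vectors are eliminated while
   v and f remain symbols: f, although computed from x in [miio_step], is not
   expanded, so the identity must hold with v, f and x independent. *)
Definition is_miio_matrix (R : realType) (n : nat) (P : 'M[R]_n) (a b : R)
    (m1 m2 : nat) (M : 'M[R]_n) : Prop :=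
  exists B C : 'M[R]_n, forall v f x x' : 'cV[R]_n,
    miio_step_with P a b m1 m2 v f x x' -> x' = M *m x + B *m v + C *m f.

(* Main.v *)
Require Import Defs.
From HB Require Import structures.
From mathcomp Require Import all_boot all_order all_algebra.
From mathcomp.real_closed Require Import complex.
From mathcomp Require Import all_classical all_reals all_analysis.
From mathcomp Require Import ring lra.

(** Everything rests on one fact: a column stochastic [P] does not increase the
    l1 norm of a column vector ([l1norm_stochastic]), whence [u = b P u + w] forces
    [(1 - b) |u| <= |w|] ([l1norm_resolvent]). In particular [I - b P] has a trivial
    kernel for [0 <= b < 1].

    The iteration matrix. Each of the two inner loops iterates an affine map of
    linear part [a P] or [b P], so their composition multiplies [x] by
    [b^m2 a^m1 P^(m1 + m2)]; the last stage applies [(a - b) P] and the resolvent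
    [(I - b P)^-1], which commutes with [P]. The coefficient of [x] in an affine
    identity that holds for all [x] is unique, whence [is_miio_matrixP]. The matrix
    satisfies [(I - b P) M = c P^k] with [c = (a - b) b^m2 a^m1], so for an
    eigenvector [u] with eigenvalue [z] the resolvent bound applied to [z u] yields
    [|z| (1 - b) <= c] ([eigenvalue_bound]); and [c <= a - b < 1 - b].

    Convergence. The matrix [M] does not govern the error of the iteration, because
    [f] itself depends on the current iterate; the spectral radius bound is
    therefore not what convergence is derived from. Instead the error with respect
    to the solution [s] of [s = a P s + (1 - a) v] is followed through one outer
    step: the loops do not increase its l1 norm ([miio_y_dist], [miio_inner_dist]),
    and the last stage contracts it by [(a - b) / (1 - b) < 1] ([miio_step_dist]).
    Finally [s] is the only complex solution of [G x = x], [e^T x = 1]: for [x] of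
    total mass 1 the equation [G x = x] is the linear system [(I - a P) x = (1 - a) v]
    ([google_fix]), whose matrix is invertible. *)

Set Implicit Arguments.
Unset Strict Implicit.
Unset Printing Implicit Defensive.

Import Order.TTheory GRing.Theory Num.Theory.
Import numFieldNormedType.Exports.

Local Open Scope classical_set_scope.
Local Open Scope ring_scope.

(** * Column eigenvectors and the l1 norm *)

Lemma det0_ker_col (F : fieldType) (n : nat) (A : 'M[F]_n) :
  \det A = 0 -> exists2 u : 'cV[F]_n, u != 0 & A *m u = 0.
Proof.
rewrite -det_tr => /eqP/det0P[w w0 wA].
exists w^T; first by rewrite -trmx0 (inj_eq trmx_inj).
by rewrite -[A]trmxK -trmx_mul wA trmx0.
Qed.

(** [eigenvalue] speaks of row vectors, whereas the l1 contraction of a column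
    stochastic matrix concerns column vectors; [A - z I] being singular mediates
    between the two. *)
Lemma eigenvalue_col (F : fieldType) (n : nat) (A : 'M[F]_n) (z : F) :
  eigenvalue A z -> exists2 u : 'cV[F]_n, u != 0 & A *m u = z *: u.
Proof.
move=> /eigenvalueP[w wA w0].
have : \det (A - z%:M) = 0.
  by apply/eqP/det0P; exists w => //; rewrite mulmxBr wA mul_mx_scalar subrr.
move=> /det0_ker_col[u u0 /eqP]; rewrite mulmxBl mul_scalar_mx subr_eq0.
by move=> /eqP Au; exists u.
Qed.

Definition l1norm (F : numDomainType) (n : nat) (u : 'cV[F]_n) : F :=
  \sum_i `|u i ord0|.

Lemma l1norm_ge0 (F : numDomainType) (n : nat) (u : 'cV[F]_n) : 0 <= l1norm u.
Proof. by apply: sumr_ge0. Qed.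

Lemma l1normD (F : numDomainType) (n : nat) (u w : 'cV[F]_n) :
  l1norm (u + w) <= l1norm u + l1norm w.
Proof.
rewrite -big_split /=; apply: ler_sum => i _.
by rewrite mxE ler_normD.
Qed.

Lemma l1normZ (F : numDomainType) (n : nat) (a : F) (u : 'cV[F]_n) :
  l1norm (a *: u) = `|a| * l1norm u.
Proof. by rewrite mulr_sumr; apply: eq_bigr => i _; rewrite mxE normrM. Qed.

Lemma l1norm_coef (F : numDomainType) (n : nat) (u : 'cV[F]_n) (i : 'I_n) :
  `|u i ord0| <= l1norm u.
Proof. by rewrite /l1norm (bigD1 i) //= lerDl sumr_ge0. Qed.

Lemma l1norm_gt0 (F : numDomainType) (n : nat) (u : 'cV[F]_n) :
  u != 0 -> 0 < l1norm u.
Proof.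
move=> u0; rewrite lt_neqAle l1norm_ge0 andbT eq_sym.
apply: contra u0; rewrite psumr_eq0 // => /allP u0; apply/eqP/matrixP => i j.
have := u0 i; rewrite mem_index_enum => /(_ isT) /=.
by rewrite normr_eq0 (ord1 j) [RHS]mxE => /eqP.
Qed.

(** * Column stochastic matrices in the l1 norm *)

(** The estimates are proved over an arbitrary [numFieldType], since they are
    used both over the reals, for convergence, and over the complex numbers, for
    the eigenvalues. *)
Section Stochastic.
Variables (F : numFieldType) (n : nat) (P : 'M[F]_n).
Hypothesis P_ge0 : forall i j, 0 <= P i j.
Hypothesis P_sum : forall j, \sum_i P i j = 1.

(** Exchanging the sums in [\sum_i \sum_j P i j |u_j|] makes the column sums,
    all equal to 1, appear. *)
Lemma l1norm_stochastic (u : 'cV[F]_n) : l1norm (P *m u) <= l1norm u.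
Proof.
have -> : l1norm u = \sum_i \sum_j P i j * `|u j ord0|.
  rewrite exchange_big; apply: eq_bigr => j _.
  by rewrite -mulr_suml P_sum mul1r.
rewrite /l1norm; apply: ler_sum => i _; rewrite mxE (le_trans (ler_norm_sum _ _ _)) //.
by apply: ler_sum => j _; rewrite normrM (ger0_norm (P_ge0 i j)).
Qed.

Lemma l1norm_stochasticX (k : nat) (u : 'cV[F]_n) :
  l1norm (P ^+ k *m u) <= l1norm u.
Proof.
elim: k => [|k IH]; first by rewrite expr0 mul1mx.
by rewrite exprS -mulmxA (le_trans (l1norm_stochastic _)).
Qed.

(** The l1 bound [1 / (1 - b)] on the resolvent [(I - b P)^-1], stated without
    the inverse so that it also serves to prove that the inverse exists. *)
Lemma l1norm_resolvent (b : F) (u w : 'cV[F]_n) : 0 <= b ->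
  u = b *: (P *m u) + w -> (1 - b) * l1norm u <= l1norm w.
Proof.
move=> b0 uE; rewrite mulrBl mul1r lerBlDl {1}uE.
apply: (le_trans (l1normD _ _)); rewrite lerD2r l1normZ ger0_norm //.
by rewrite ler_wpM2l ?l1norm_stochastic.
Qed.

Lemma resolvent_unit (b : F) : 0 <= b < 1 -> 1%:M - b *: P \in unitmx.
Proof.
move=> /andP[b0 b1]; rewrite unitmxE unitfE; apply/eqP => /det0_ker_col[u u0].
move/eqP; rewrite mulmxBl mul1mx -scalemxAl subr_eq0 => /eqP uE.
have /(l1norm_resolvent b0) : u = b *: (P *m u) + 0 by rewrite addr0.
rewrite {2}/l1norm big1; last by move=> i _; rewrite mxE normr0.
by rewrite lt_geF // mulr_gt0 ?subr_gt0 ?l1norm_gt0.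
Qed.

(** If [M u = z u] then [(I - b P) (z u) = c P^k u]; the right-hand side has l1
    norm at most [c |u|], so the resolvent bound gives [(1 - b) |z| |u| <= c |u|]. *)
Lemma eigenvalue_bound (b c z : F) (k : nat) (M : 'M[F]_n) :
  0 <= b < 1 -> 0 <= c -> (1%:M - b *: P) *m M = c *: P ^+ k ->
  eigenvalue M z -> `|z| <= c / (1 - b).
Proof.
move=> /andP[b0 b1] c0 ME /eigenvalue_col[u u0 Mu].
have zuE : z *: u = b *: (P *m (z *: u)) + c *: (P ^+ k *m u).
  by rewrite (scalemxAl c) -ME -mulmxA Mu mulmxBl mul1mx -(scalemxAl b) subrKC.
have := l1norm_resolvent b0 zuE.
rewrite !l1normZ (ger0_norm c0) => h.
rewrite ler_pdivlMr ?subr_gt0 // -(ler_pM2r (l1norm_gt0 u0)).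
rewrite (mulrC `|z|) -mulrA (le_trans h) //.
by rewrite ler_wpM2l // l1norm_stochasticX.
Qed.

End Stochastic.

(** * The Google fixed point as a linear system *)

Section PageRank.
Variables (R : realType) (n : nat) (P : 'M[R]_n) (a : R).
Hypotheses (P_stoch : column_stochastic P) (a01 : 0 <= a < 1).

Let P_ge0 : forall i j, 0 <= P i j. Proof. by case: P_stoch. Qed.
Let P_sum : forall j, \sum_i P i j = 1. Proof. by case: P_stoch. Qed.

(** The solution of the linear system [(I - a P) x = (1 - a) v], which turns out
    to be the stationary vector of the Google matrix. *)
Definition pagerank : 'cV[R]_n :=
  invmx (1%:M - a *: P) *m ((1 - a) *: unif R n).

Lemma pagerank_fix : pagerank = a *: (P *m pagerank) + (1 - a) *: unif R n.
Proof.
have U := resolvent_unit P_ge0 P_sum a01.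
apply/eqP; rewrite addrC -subr_eq scalemxAl -{1}[pagerank]mul1mx -mulmxBl.
by rewrite /pagerank mulKVmx.
Qed.

Lemma ones_stochastic : (ones R n)^T *m P = (ones R n)^T.
Proof.
apply/matrixP => i j; rewrite !mxE -[RHS](P_sum j).
by apply: eq_bigr => k _; rewrite !mxE mul1r.
Qed.

Lemma ones_unif : (0 < n)%N -> (ones R n)^T *m unif R n = 1%:M.
Proof.
move=> n0; apply/matrixP => i j; rewrite !mxE !ord1 eqxx.
under eq_bigr do rewrite !mxE mulr1 mul1r.
by rewrite sumr_const card_ord -[LHS]mulr_natl divff // pnatr_eq0 -lt0n.
Qed.

(** Applying [e^T] to the fixed-point equation gives [t = a t + (1 - a)] for the
    total mass [t], and [a] is not 1. *)
Lemma pagerank_sum : (0 < n)%N -> (ones R n)^T *m pagerank = 1%:M.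
Proof.
move=> n0; have /(congr1 (mulmx (ones R n)^T)) := pagerank_fix.
rewrite mulmxDr -2!scalemxAr (mulmxA _ P) ones_stochastic ones_unif //.
set e := _ *m _ => /eqP; rewrite addrC -subr_eq -{1}[e]scale1r -scalerBl.
rewrite (inj_eq (scalerI _)); first by move/eqP.
by case/andP: a01 => _ a1; rewrite gt_eqF // subr_gt0.
Qed.

(** On vectors of total mass 1 the rank-one part [v e^T] of the Google matrix
    acts as the constant [v]; this turns the eigenvector problem [G x = x] into
    the linear system that defines [pagerank], and is what gives uniqueness. *)
Lemma google_fix (x : 'cV[R[i]]_n) :
  (toC (ones R n))^T *m x = 1%:M ->
  toC (google P a) *m x = toC (a *: P) *m x + toC ((1 - a) *: unif R n).
Proof.
move=> x1; rewrite /google /toC map_mxD mulmxDl; congr (_ + _).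
by rewrite scalemxAl map_mxM -mulmxA -map_trmx x1 mulmx1.
Qed.

Lemma pagerank_unique : (0 < n)%N ->
  unique (fun x : 'cV[R[i]^o]_n =>
    toC (google P a) *m x = x /\ (toC (ones R n))^T *m x = 1%:M) (toC pagerank).
Proof.
move=> n0.
have p1 : (toC (ones R n))^T *m toC pagerank = 1%:M.
  by rewrite /toC map_trmx -map_mxM pagerank_sum // map_mx1.
have pE : toC (a *: P) *m toC pagerank + toC ((1 - a) *: unif R n) = toC pagerank.
  by rewrite /toC -map_mxM -map_mxD -scalemxAl -pagerank_fix.
split; first by split=> //; rewrite google_fix.
move=> x [xE x1].
have U : toC (1%:M - a *: P) \in unitmx.
  by rewrite map_unitmx resolvent_unit.
have key (y : 'cV[R[i]]_n) :
    toC (a *: P) *m y + toC ((1 - a) *: unif R n) = y ->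
    toC (1%:M - a *: P) *m y = toC ((1 - a) *: unif R n).
  move=> yE; apply/eqP; rewrite /toC map_mxB map_mx1 mulmxBl mul1mx.
  by rewrite subr_eq addrC yE.
by apply: (can_inj (mulKmx U)); rewrite !key // -google_fix.
Qed.

End PageRank.

(** * The outer step as an affine map *)

Lemma iter_affine (F : fieldType) (n : nat) (P : 'M[F]_n) (a : F)
    (g x : 'cV[F]_n) (m : nat) :
  iter m (fun y => a *: (P *m y) + g) x =
  a ^+ m *: (P ^+ m *m x) + (\sum_(k < m) a ^+ k *: P ^+ k) *m g.
Proof.
elim: m => [|m IH]; first by rewrite big_ord0 mul0mx addr0 !expr0 scale1r mul1mx.
rewrite iterS IH big_ord_recl /= !expr0 scale1r mulmxDl mul1mx.
rewrite mulmxDr -scalemxAr (mulmxA P (P ^+ m)) scalerDr scalerA -exprS.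
rewrite -[P *m P ^+ m]exprS.
rewrite -addrA; congr (_ + _); rewrite addrC; congr (_ + _).
rewrite mulmxA mulmx_sumr scalemxAl scaler_sumr; congr (_ *m _).
by apply: eq_bigr => k _; rewrite -scalemxAr scalerA -exprS -[P *m P ^+ k]exprS.
Qed.

Lemma comm_mx_inv (F : fieldType) (n : nat) (A B : 'M[F]_n) :
  A \in unitmx -> A *m B = B *m A -> invmx A *m B = B *m invmx A.
Proof.
move=> uA AB.
by rewrite -[in LHS](mulmxK uA B) -AB mulmxA mulmxA mulVmx // mul1mx.
Qed.

Lemma map_mxX (A B : nzRingType) (g : {rmorphism A -> B}) (n k : nat)
    (M : 'M[A]_n) :
  map_mx g (M ^+ k) = map_mx g M ^+ k.
Proof. exact: rmorphXn. Qed.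

Section MIIO.
Variables (R : realType) (n : nat) (P : 'M[R]_n) (a b : R).
Variables (m1 m2 : nat).
Hypothesis P_stoch : column_stochastic P.
Hypotheses (b_gt0 : 0 < b) (b_lta : b < a) (a_lt1 : a < 1).

Let P_ge0 : forall i j, 0 <= P i j. Proof. by case: P_stoch. Qed.
Let P_sum : forall j, \sum_i P i j = 1. Proof. by case: P_stoch. Qed.
Ltac bounds_lra := move: b_gt0 b_lta a_lt1; lra.

Let b01 : 0 <= b < 1. Proof. by apply/andP; split; bounds_lra. Qed.

Definition miio_scalar : R := (a - b) * b ^+ m2 * a ^+ m1.

Definition miio_matrix : 'M[R]_n :=
  miio_scalar *: (P ^+ (m1 + m2 + 1) *m invmx (1%:M - b *: P)).

Lemma resolvent_unit_b : 1%:M - b *: P \in unitmx.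
Proof. exact: resolvent_unit. Qed.

Lemma resolventX (k : nat) :
  (1%:M - b *: P) *m P ^+ k = P ^+ k *m (1%:M - b *: P).
Proof.
rewrite mulmxBl mulmxBr mul1mx mulmx1 -scalemxAl -scalemxAr.
by rewrite -[P *m P ^+ k]exprS -[P ^+ k *m P]exprSr.
Qed.

Lemma miio_matrixE : (1%:M - b *: P) *m miio_matrix =
  miio_scalar *: P ^+ (m1 + m2 + 1).
Proof.
rewrite -scalemxAr mulmxA resolventX mulmxK //; exact: resolvent_unit_b.
Qed.

Lemma miio_step_withE (v f x x' : 'cV[R]_n) :
  miio_step_with P a b m1 m2 v f x x' <->
  x' = invmx (1%:M - b *: P) *m
    ((a - b) *: (P *m miio_inner P b m2 f (miio_y P a m1 v x)) + (1 - a) *: v).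
Proof.
have U := resolvent_unit_b.
by split=> [<-|->]; rewrite ?mulKmx// /miio_step_with mulKVmx.
Qed.

(** Both inner loops are iterated affine maps, so [iter_affine] gives the
    coefficients of [x], [v] and [f]; the resolvent, which the elimination puts
    on the left, commutes with the powers of [P]. *)
Lemma miio_matrix_is_miio : is_miio_matrix P a b m1 m2 miio_matrix.
Proof.
set N := invmx (1%:M - b *: P).
set S := fun c m => \sum_(k < m) c ^+ k *: P ^+ k : 'M[R]_n.
exists (N *m ((a - b) *: (P *m (b ^+ m2 *: (P ^+ m2 *m ((1 - a) *: S a m1))))
              + (1 - a)%:M)).
exists (N *m ((a - b) *: (P *m S b m2))) => v f x x' /miio_step_withE ->.
rewrite /miio_inner /miio_y !iter_affine -!/(S _ _).
have -> : miio_matrix = N *m ((a - b) *: (P *m (b ^+ m2 *: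
    (P ^+ m2 *m (a ^+ m1 *: P ^+ m1))))).
  rewrite -!scalemxAr !scalerA -[P ^+ m2 *m P ^+ m1]exprD.
  rewrite -[P *m P ^+ (m2 + m1)]exprS comm_mx_inv.
  - by rewrite /miio_matrix /miio_scalar addn1 (addnC m1).
  - exact: resolvent_unit_b.
  - exact: resolventX.
rewrite -!mulmxA -!mulmxDr; congr (_ *m _).
rewrite mulmxDl mul_scalar_mx; do 4![rewrite -?scalemxAl -?mulmxA].
do 4![rewrite ?mulmxDr ?scalerDr -?scalemxAr]; rewrite !scalerA.
by rewrite -!addrA; do 2![congr (_ + _)]; rewrite addrC.
Qed.

(** The coefficient of [x] is unique: with [v = f = 0] every [x] has a successor
    [x'], which each candidate matrix must map [x] to; the basis vectors [x]
    recover the columns. *)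
Lemma is_miio_matrixP (M : 'M[R]_n) :
  is_miio_matrix P a b m1 m2 M <-> M = miio_matrix.
Proof.
split=> [[B [C MBC]]|->]; last exact: miio_matrix_is_miio.
have [B' [C' MBC']] := miio_matrix_is_miio.
apply/matrixP => i j.
have [x' x'E] : exists x', miio_step_with P a b m1 m2 0 0 (delta_mx j ord0) x'.
  by eexists; apply/miio_step_withE.
have := MBC _ _ _ _ x'E; rewrite (MBC' _ _ _ _ x'E) !mulmx0 !addr0.
by move=> /matrixP/(_ i ord0); rewrite -!colE !mxE.
Qed.

(** * Eigenvalues of the iteration matrix *)

Lemma miio_scalar_ge0 : 0 <= miio_scalar.
Proof. by rewrite !mulr_ge0 ?exprn_ge0 //; bounds_lra. Qed.

Lemma miio_bound_lt1 : miio_scalar / (1 - b) < 1.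
Proof.
rewrite ltr_pdivrMr ?mul1r; last by bounds_lra.
suff : miio_scalar <= a - b by bounds_lra.
rewrite /miio_scalar -mulrA ler_piMr ?mulr_ile1 ?exprn_ge0 ?exprn_ile1 //;
  bounds_lra.
Qed.

Lemma miio_eigenvalue (z : R[i]) :
  eigenvalue (toC miio_matrix : 'M[R[i]]_n) z ->
  modulus z <= miio_scalar / (1 - b).
Proof.
move=> zE; rewrite -lecR.
have -> : (modulus z)%:C%C = `|z| by [].
rewrite rmorphM fmorphV rmorphB rmorph1.
apply: (@eigenvalue_bound R[i] n (map_mx (real_complex R) P) _ _ _ _ _
  (m1 + m2 + 1) (toC miio_matrix)) => //.
- by move=> i j; rewrite mxE ler0c.
- move=> j; rewrite -[RHS](rmorph1 (real_complex R)) -(P_sum j) rmorph_sum.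
  by apply: eq_bigr => i _; rewrite mxE.
- by rewrite ler0c -(rmorph1 (real_complex R)) ltcR.
- by rewrite ler0c miio_scalar_ge0.
- rewrite -map_mxX -!map_mxZ -(map_mx1 (real_complex R)) -map_mxB -map_mxM.
  by rewrite miio_matrixE.
Qed.

Lemma miio_spectral_radius : spectral_radius miio_matrix < 1.
Proof.
rewrite /spectral_radius; set E := [set _ | _ in _].
have [->|E0] := eqVneq E set0; first by rewrite sup0 ltr01.
apply: le_lt_trans miio_bound_lt1; apply: ge_sup; first exact/set0P.
by move=> _ [z zE <-]; apply: miio_eigenvalue.
Qed.

(** * Convergence of the iterates *)

(** When [f] is computed from [y] and [s] solves [s = a P s + (1 - a) v], the
    defect of [s] in the inner recursion is [(a - b) P (y - s)]. The errors then
    obey [e_j <= b e_(j-1) + (a - b) e_0], and [b + (a - b) = a < 1] keeps them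
    below [e_0]. *)
Lemma miio_inner_dist (f y s : 'cV[R]_n) :
  b *: (P *m s) + f - s = (a - b) *: (P *m (y - s)) ->
  l1norm (miio_inner P b m2 f y - s) <= l1norm (y - s).
Proof.
move=> fE; rewrite /miio_inner; elim: m2 => [//|m IH]; rewrite iterS.
set z := iter m _ _ in IH *.
have -> : b *: (P *m z) + f - s =
          b *: (P *m (z - s)) + (a - b) *: (P *m (y - s)).
  by rewrite -fE mulmxBr scalerBr !addrA subrK.
apply: le_trans (l1normD _ _) _; rewrite !l1normZ !ger0_norm; try bounds_lra.
apply: (@le_trans _ _ (b * l1norm (y - s) + (a - b) * l1norm (y - s))).
  rewrite lerD // ler_wpM2l ?(l1norm_stochastic P_ge0) //; try bounds_lra.
  exact: le_trans (l1norm_stochastic P_ge0 P_sum _) IH.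
rewrite -mulrDl ler_piMl ?l1norm_ge0 //; bounds_lra.
Qed.

Lemma miio_y_dist (v x s : 'cV[R]_n) : s = a *: (P *m s) + (1 - a) *: v ->
  l1norm (miio_y P a m1 v x - s) <= l1norm (x - s).
Proof.
move=> sE; rewrite /miio_y; elim: m1 => [//|m IH]; rewrite iterS.
set z := iter m _ _ in IH *.
have -> : a *: (P *m z) + (1 - a) *: v - s = a *: (P *m (z - s)).
  by rewrite {1}sE opprD addrACA subrr addr0 mulmxBr scalerBr.
rewrite l1normZ ger0_norm; last by bounds_lra.
apply: le_trans IH; apply: le_trans (l1norm_stochastic P_ge0 P_sum _).
rewrite ler_piMl ?l1norm_ge0 //; bounds_lra.
Qed.

(** The first stage does not increase the l1 error, and the implicit second stage
    multiplies it by at most [(a - b) / (1 - b)], by the resolvent bound. *)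
Lemma miio_step_dist (v x x' s : 'cV[R]_n) :
  s = a *: (P *m s) + (1 - a) *: v -> miio_step P a b m1 m2 v x x' ->
  l1norm (x' - s) <= (a - b) / (1 - b) * l1norm (x - s).
Proof.
move=> sE; rewrite /miio_step /miio_step_with.
set y := miio_y P a m1 v x; set z := miio_inner _ _ _ _ _.
rewrite mulmxBl mul1mx -scalemxAl => /eqP; rewrite subr_eq => /eqP x'E.
(* Both [x'] and [s] satisfy [u = b P u + (a - b) P w + (1 - a) v], with [w] equal
   to [z] and to [s] respectively; their difference loses the constant term. *)
have x'sE : x' - s = b *: (P *m (x' - s)) + (a - b) *: (P *m (z - s)).
  rewrite {1}x'E {1}sE !mulmxBr !scalerBr scalerBl.
  by apply/matrixP => i j; rewrite !mxE; ring.
have zs : l1norm (z - s) <= l1norm (y - s).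
  apply: miio_inner_dist; rewrite /miio_f {2}sE mulmxBr !scalerBr !scalerBl.
  by apply/matrixP => i j; rewrite !mxE; ring.
have ys := miio_y_dist x sE.
have b0 : 0 <= b by bounds_lra.
have := l1norm_resolvent P_ge0 P_sum b0 x'sE.
rewrite l1normZ ger0_norm; last by bounds_lra.
have := l1norm_stochastic P_ge0 P_sum (z - s).
rewrite mulrAC ler_pdivlMr; last by bounds_lra.
rewrite mulrC => h1 /le_trans; apply; rewrite ler_wpM2l //; first bounds_lra.
exact: le_trans h1 (le_trans zs ys).
Qed.

(** An l1 error bounds every entry, and a positive complex radius is a positive
    real one, so real l1 convergence suffices for convergence in C^n. *)
Lemma cvg_toC (x : nat -> 'cV[R]_n) (s : 'cV[R]_n) :
  l1norm (x l - s) @[l --> \oo] --> (0 : R) ->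
  (fun l => toC (x l)) @ \oo --> toC s.
Proof.
move=> /cvgr0Pnorm_lt xs; apply/cvg_ballP => e e0.
have eE : e = (complex.Re e)%:C%C.
  by move: e0; rewrite ltcE; case: (e) => p q /= /andP[/eqP -> _].
have re0 : 0 < complex.Re e by rewrite -ltcR -eE.
near=> l; split=> // i j; rewrite -ball_normE /ball_ /= !mxE (ord1 j).
rewrite distrC -rmorphB normc_def /= expr0n addr0 sqrtr_sqr eE ltcR.
apply: le_lt_trans (_ : l1norm (x l - s) < _).
  by have := l1norm_coef (x l - s) i; rewrite !mxE.
rewrite -[ltLHS]ger0_norm ?l1norm_ge0 //.
by near: l; apply: xs.
Unshelve. all: by end_near. Qed.

Lemma miio_cvg (v s : 'cV[R]_n) (x : nat -> 'cV[R]_n) :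
  s = a *: (P *m s) + (1 - a) *: v ->
  (forall l, miio_step P a b m1 m2 v (x l) (x l.+1)) ->
  (fun l => toC (x l)) @ \oo --> toC s.
Proof.
move=> sE xE; apply: cvg_toC; set q := (a - b) / (1 - b).
have q0 : 0 <= q by rewrite divr_ge0 //; bounds_lra.
have q1 : q < 1 by rewrite ltr_pdivrMr ?mul1r; bounds_lra.
have xq l : l1norm (x l - s) <= q ^+ l * l1norm (x 0%N - s).
  elim: l => [|l IH]; first by rewrite expr0 mul1r.
  apply: le_trans (miio_step_dist sE (xE l)) _.
  by rewrite -/q exprS -mulrA ler_wpM2l.
apply: (@squeeze_cvgr _ _ _ _ (fun=> 0) (fun l => q ^+ l * l1norm (x 0%N - s))).
- by near=> l; rewrite l1norm_ge0 xq.
- exact: cvg_cst.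
- rewrite -[X in _ --> X](mul0r (l1norm (x 0%N - s))).
  by apply: cvgMl; apply: cvg_expr; rewrite ger0_norm.
Unshelve. all: by end_near. Qed.

End MIIO.

Unset Implicit Arguments.

Theorem theorem1 (R : realType) (n : nat) (P : 'M[R]_n) (alpha beta : R)
    (m1 m2 : nat) (hn : (0 < n)%N) (hP : column_stochastic P)
    (halpha : 0 < alpha < 1) (hbeta : 0 < beta < alpha)
    (hm1 : (1 <= m1)%N) (hm2 : (1 <= m2)%N) :
  [/\ 1%:M - beta *: P \in unitmx,
      forall M : 'M[R]_n, is_miio_matrix P alpha beta m1 m2 M <->
        M = ((alpha - beta) * beta ^+ m2 * alpha ^+ m1) *:
              (P ^+ (m1 + m2 + 1) *m invmx (1%:M - beta *: P)),
      forall M : 'M[R]_n, is_miio_matrix P alpha beta m1 m2 M ->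
        (forall z : R[i], eigenvalue (toC M : 'M[R[i]]_n) z ->
           modulus z <=
             (alpha - beta) * beta ^+ m2 * alpha ^+ m1 / (1 - beta)) /\
        spectral_radius M < 1
    & exists xstar : 'cV[R[i]^o]_n,
        unique (fun x : 'cV[R[i]^o]_n =>
                  toC (google P alpha) *m x = x /\
                  (toC (ones R n))^T *m x = 1%:M) xstar /\
        forall x : nat -> 'cV[R]_n,
          miio_iterates P alpha beta m1 m2 (unif R n) x ->
          (fun l => toC (x l)) @ \oo --> xstar].
Proof.
have [/andP[a_gt0 a_lt1] /andP[b_gt0 b_lta]] := (halpha, hbeta).
have a01 : 0 <= alpha < 1 by rewrite ltW.
split.
- exact: (resolvent_unit_b hP b_gt0 b_lta a_lt1).
- exact: is_miio_matrixP.
- move=> M /is_miio_matrixP -> //.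
  by split; [exact: miio_eigenvalue|exact: miio_spectral_radius].
- exists (toC (pagerank P alpha)); split; first 
  exact: (pagerank_unique hP a01 hn).
  move=> x [_ xE]; apply: (miio_cvg hP b_gt0 b_lta a_lt1 _ xE).
  exact: pagerank_fix.
Qed.
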